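(* Let $\mathcal V$ be a variety of loops. Let $X$ be a finite loop such that each subloop $Y\le X$ either belongs to $\mathcal V$ or is nonabelian and simple. If an equation $\varepsilon$ (in the signature of loops) propagates in both $X$ and $\mathcal V$, then $\varepsilon$ also propagates in the variety $\mathbf{HSP}(X)\lor\mathcal V$.
   Context: A loop is an algebra $(X,\cdot,\backslash,/,e)$ satisfying $x(x\backslash y)=y=x\backslash(xy)$, $(x/y)y=x=(xy)/y$ and $ex=xe=x$; subloops and homomorphisms are those of this signature. A normal subloop is the kernel of a loop homomorphism. A loop is abelian if it is an abelian group, and nonabelian otherwise (so a nonabelian loop may be commutative). A loop $X$ is simple if its only normal subloops are $\{e\}$ and $X$. A variety is an equationally defined class of algebras; $\mathbf{HSP}(X)$ is the smallest variety containing $X$, and $\mathcal V_1\lor\mathcal V_2$ is the smallest variety containing $\mathcal V_1\cup\mathcal V_2$. An equation $\varepsilon=\varepsilon(x_1,\dots,x_n)$ with $n$ variables in the signature of an algebra $X$ propagates in $X$ if for all $x_1,\dots,x_n\in X$: if $\varepsilon(x_1,\dots,x_n)$ holds, then $\varepsilon(y_1,\dots,y_n)$ holds for all $y_1,\dots,y_n$ in the subalgebra $\langle x_1,\dots,x_n\rangle$ of $X$ generated by $x_1,\dots,x_n$. An equation propagates in a class of algebras if it propagates in every member of the class. *)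

(* Defs.v *)
From mathcomp Require Import all_boot.
From mathcomp Require Import boolp classical_sets functions cardinality.

Set Implicit Arguments.
Unset Strict Implicit.
Unset Printing Implicit Defensive.

Local Open Scope classical_set_scope.

Record loop := Loop {
  carrier :> Type;
  lmul : carrier -> carrier -> carrier;
  lldiv : carrier -> carrier -> carrier;   (* lldiv x y = x \ y *)
  lrdiv : carrier -> carrier -> carrier;   (* lrdiv x y = x / y *)
  lone : carrier;
  loop_mul_ldiv : forall x y, lmul x (lldiv x y) = y;
  loop_ldiv_mul : forall x y, lldiv x (lmul x y) = y;
  loop_rdiv_mul : forall x y, lmul (lrdiv x y) y = x;
  loop_mul_rdiv : forall x y, lrdiv (lmul x y) y = x;
  loop_mul_1l : forall x, lmul lone x = x;
  loop_mul_1r : forall x, lmul x lone = x }.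

Arguments lmul {l} x y.
Arguments lldiv {l} x y.
Arguments lrdiv {l} x y.
Arguments lone {l}.

Definition is_hom (X Y : loop) (f : X -> Y) : Prop :=
  [/\ {morph f : x y / lmul x y}, {morph f : x y / lldiv x y},
      {morph f : x y / lrdiv x y} & f lone = lone].

Definition is_subloop (X : loop) (S : set X) : Prop :=
  [/\ S lone, (forall x y, S x -> S y -> S (lmul x y)),
      (forall x y, S x -> S y -> S (lldiv x y)) &
      (forall x y, S x -> S y -> S (lrdiv x y))].

Definition generated_subloop (X : loop) (A : set X) : set X :=
  smallest (@is_subloop X) A.

Section SubloopAsLoop.
Variables (X : loop) (S : set X) (HS : is_subloop S).

Let T := {x : X | S x}.

Definition sub_mul (x y : T) : T :=
  exist S (lmul (sval x) (sval y))
    (let: And4 _ h _ _ := HS in h _ _ (svalP x) (svalP y)).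
Definition sub_ldiv (x y : T) : T :=
  exist S (lldiv (sval x) (sval y))
    (let: And4 _ _ h _ := HS in h _ _ (svalP x) (svalP y)).
Definition sub_rdiv (x y : T) : T :=
  exist S (lrdiv (sval x) (sval y))
    (let: And4 _ _ _ h := HS in h _ _ (svalP x) (svalP y)).
Definition sub_one : T := exist S lone (let: And4 h _ _ _ := HS in h).

Let sval_inj (x y : T) : sval x = sval y -> x = y.
Proof. by apply: eq_sig_hprop => z; apply: Prop_irrelevance. Qed.

Definition loop_of_subloop : loop.
Proof.
apply: (@Loop T sub_mul sub_ldiv sub_rdiv sub_one) => *; apply: sval_inj => /=.
- exact: loop_mul_ldiv.
- exact: loop_ldiv_mul.
- exact: loop_rdiv_mul.
- exact: loop_mul_rdiv.
- exact: loop_mul_1l.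
- exact: loop_mul_1r.
Defined.

End SubloopAsLoop.

Definition is_normal_subloop (X : loop) (N : set X) : Prop :=
  exists (Y : loop) (f : X -> Y), is_hom f /\ N = f @^-1` [set lone].

Definition is_simple (X : loop) : Prop :=
  forall N : set X, is_normal_subloop N -> N = [set lone] \/ N = [set: X].

Definition is_abelian (X : loop) : Prop :=
  exists inv : X -> X,
    [/\ associative (@lmul X), commutative (@lmul X),
        left_id (@lone X) (@lmul X) & left_inverse (@lone X) inv (@lmul X)].

Inductive loop_term (I : Type) : Type :=
  | Var of I
  | One
  | Mul of loop_term I & loop_term I
  | LDiv of loop_term I & loop_term I
  | RDiv of loop_term I & loop_term I.

Arguments One {I}.

Fixpoint loop_eval (I : Type) (X : loop) (v : I -> X) (t : loop_term I) : X :=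
  match t with
  | Var i => v i
  | One => lone
  | Mul t1 t2 => lmul (loop_eval v t1) (loop_eval v t2)
  | LDiv t1 t2 => lldiv (loop_eval v t1) (loop_eval v t2)
  | RDiv t1 t2 => lrdiv (loop_eval v t1) (loop_eval v t2)
  end.

Definition loop_equation (I : Type) : Type := (loop_term I * loop_term I)%type.

Definition holds_at (I : Type) (X : loop) (eps : loop_equation I) (v : I -> X) : Prop :=
  loop_eval v eps.1 = loop_eval v eps.2.

Definition satisfies (I : Type) (X : loop) (eps : loop_equation I) : Prop :=
  forall v : I -> X, holds_at eps v.

(* Classes of loops are written [loop -> Prop], not [set loop]: [set] is
   universe-monomorphic, so [set loop] would prevent loops whose elements are
   themselves sets (such as cosets). *)
Definition is_variety (V : loop -> Prop) : Prop :=
  exists E : set (loop_equation nat),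
    forall X : loop, V X <-> (forall eps, E eps -> satisfies X eps).

Definition generated_variety (K : loop -> Prop) : loop -> Prop :=
  fun Y => forall W : loop -> Prop,
    is_variety W -> (forall X, K X -> W X) -> W Y.

Lemma generated_variety_is_variety (K : loop -> Prop) :
  is_variety (generated_variety K).
Proof.
exists [set eps | forall X, K X -> satisfies X eps] => Y; split.
- move=> KY eps Keps; apply: (KY (fun X => satisfies X eps)) => //.
  by exists [set eps] => X; split=> [? _ -> //|]; apply.
- by move=> EY W [E WE] KW; apply/WE => eps Eeps; apply: EY => X /KW /WE; apply.
Qed.

Definition HSP (X : loop) : loop -> Prop := generated_variety (fun Y => Y = X).

Definition variety_join (V1 V2 : loop -> Prop) : loop -> Prop :=
  generated_variety (fun Y => V1 Y \/ V2 Y).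

Definition propagates (n : nat) (eps : loop_equation 'I_n) (X : loop) : Prop :=
  forall x : 'I_n -> X, holds_at eps x ->
  forall y : 'I_n -> X,
    (forall i, generated_subloop (range x) (y i)) -> holds_at eps y.

Definition propagates_in (n : nat) (eps : loop_equation 'I_n) (K : loop -> Prop) : Prop :=
  forall X : loop, K X -> propagates eps X.

(* Main.v *)
(** Let [Y] lie in the join and let [x] be a tuple of [Y] satisfying [eps].
    Congruences are taken on the algebra of terms and contain the loop
    identities, so they permute. Let [K] be the kernel of evaluation at [x],
    [G] the identities of [V], and [H a] the kernel of evaluation at a tuple [a]
    of [X]. The meet of [G] and of the finitely many [H a] is contained in [K].
    A consequence [w] of [eps] lies in [K o G] because [eps] propagates in [V].
    It then suffices to show that [w] in [K o G'] implies [w] in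
    [K o (G' /\ H a)]. If the image of [a] generates a loop of [V], then
    [G' <= H a]. Otherwise the quotient by [H a] is nonabelian and simple, so
    [H a] is maximal: either [K <= H a], and [w] is in [H a] because [eps]
    propagates in [X], or [G' <= H a], or [K /\ G'] is not contained in [H a],
    since otherwise the commutators and associators of the quotient, which come
    from [K /\ G'], would vanish; maximality then gives the claim. *)
Require Import Defs.
From mathcomp Require Import all_boot.
From mathcomp Require Import boolp classical_sets functions cardinality.

Set Implicit Arguments.
Unset Strict Implicit.
Unset Printing Implicit Defensive.

Local Open Scope classical_set_scope.

(** * Terms, substitution and generated subloops *)

Lemma sval_inj (T : Type) (P : T -> Prop) : injective (@sval T P).
Proof.
by move=> x y; apply: eq_sig_hprop => z; exact: Prop_irrelevance.
Qed.

Fixpoint subst (I J : Type) (s : I -> loop_term J) (t : loop_term I) :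
    loop_term J :=
  match t with
  | Var i => s i
  | One => One
  | Mul t1 t2 => Mul (subst s t1) (subst s t2)
  | LDiv t1 t2 => LDiv (subst s t1) (subst s t2)
  | RDiv t1 t2 => RDiv (subst s t1) (subst s t2)
  end.

Lemma eval_subst (I J : Type) (X : loop) (v : J -> X) (s : I -> loop_term J) t :
  loop_eval v (subst s t) = loop_eval (fun i => loop_eval v (s i)) t.
Proof. by elim: t => //= t1 -> t2 ->. Qed.

Lemma hom_eval (I : Type) (X Y : loop) (f : X -> Y) (v : I -> X) t :
  is_hom f -> f (loop_eval v t) = loop_eval (fun i => f (v i)) t.
Proof.
case=> fM fL fR f1; elim: t => //= t1 <- t2 <-; by rewrite ?fM ?fL ?fR.
Qed.

Lemma sval_hom (X : loop) (S : set X) (HS : is_subloop S) :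
  is_hom (sval : loop_of_subloop HS -> X).
Proof. by []. Qed.

Lemma subloop_eval (I : Type) (X : loop) (S : set X) (v : I -> X) t :
  is_subloop S -> range v `<=` S -> S (loop_eval v t).
Proof.
case=> S1 SM SL SR vS.
by elim: t => [i||||] //=; [apply: vS; exists i|move=> *; auto..].
Qed.

Lemma range_eval_subloop (I : Type) (X : loop) (v : I -> X) :
  is_subloop (range (loop_eval v)).
Proof.
split; first by exists One.
- by move=> _ _ [p _ <-] [q _ <-]; exists (Mul p q).
- by move=> _ _ [p _ <-] [q _ <-]; exists (LDiv p q).
- by move=> _ _ [p _ <-] [q _ <-]; exists (RDiv p q).
Qed.

Lemma generated_range_eval (I : Type) (X : loop) (v : I -> X) :
  generated_subloop (range v) = range (loop_eval v).
Proof.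
apply/seteqP; split=> [y|_ [p _ <-]].
  apply; split; first exact: range_eval_subloop.
  by move=> _ [i _ <-]; exists (Var i).
by move=> S [HS vS]; exact: subloop_eval.
Qed.

(** The subloop generated by [x] consists of the values at [x] of terms in the same variables, so
    propagation becomes closure under substitution of such terms. *)
Lemma propagates_subst (n : nat) (eps : loop_equation 'I_n) (X : loop)
    (x : 'I_n -> X) (s : 'I_n -> loop_term 'I_n) :
  propagates eps X -> holds_at eps x ->
  holds_at (subst s eps.1, subst s eps.2) x.
Proof.
move=> prop ex; rewrite /holds_at /= !eval_subst; apply: prop ex _ _ => i.
by rewrite generated_range_eval; exists (s i).
Qed.

Lemma satisfies_variety (n : nat) (p q : loop_term 'I_n) :
  is_variety (fun Y => satisfies Y (p, q)).
Proof.
pose s (i : 'I_n) : loop_term nat := Var (val i).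
exists [set (subst s p, subst s q)] => Y; split=> [Ypq _ -> v | Ypq v].
  by rewrite /holds_at /= !eval_subst; exact: Ypq.
(* Indices outside ['I_n] get the dummy value [lone]; they do not occur in the renamed terms. *)
have := Ypq _ erefl (fun k => if insub k is Some i then v i else lone).
rewrite /holds_at /= !eval_subst /=.
suff -> : (fun i : 'I_n =>
    if insub (val i) is Some j then v j else lone) = v by [].
by apply/funext => i; rewrite valK.
Qed.

Lemma satisfies_generated_variety (n : nat) (K : loop -> Prop)
    (p q : loop_term 'I_n) :
  (forall X, K X -> satisfies X (p, q)) ->
  forall Y, generated_variety K Y -> satisfies Y (p, q).
Proof. by move=> Kpq Y YK; exact: YK (satisfies_variety _ _) Kpq. Qed.

(** * Congruences on terms containing the loop identities *)

Section Congruences.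
Variable I : Type.
Notation term := (loop_term I).
Implicit Types (p q r : term) (E F G : term -> term -> Prop).

(** [cong_id] puts every pair of terms equal in all loops into [E]; this yields reflexivity and
    makes the quotient of the term algebra a loop. *)
Record loop_cong E : Prop := LoopCong {
  cong_id : forall p q,
    (forall (X : loop) (v : I -> X), loop_eval v p = loop_eval v q) -> E p q;
  cong_sym : forall p q, E p q -> E q p;
  cong_trans : forall q p r, E p q -> E q r -> E p r;
  cong_mul : forall p p' q q', E p p' -> E q q' -> E (Mul p q) (Mul p' q');
  cong_ldiv : forall p p' q q', E p p' -> E q q' -> E (LDiv p q) (LDiv p' q');
  cong_rdiv : forall p p' q q', E p p' -> E q q' -> E (RDiv p q) (RDiv p' q')
}.

Definition meet_rel E F p q := E p q /\ F p q.
Definition comp_rel E F p q := exists2 r, E p r & F r q.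
Definition eval_rel (X : loop) (v : I -> X) p q := loop_eval v p = loop_eval v q.
Definition identities (V : loop -> Prop) p q :=
  forall X : loop, V X -> satisfies X (p, q).

Lemma cong_refl E p : loop_cong E -> E p p.
Proof. by move=> cE; apply: (cong_id cE). Qed.

Lemma eval_cong (X : loop) (v : I -> X) : loop_cong (eval_rel v).
Proof.
split; rewrite /eval_rel //=; first by move=> q p r -> ->.
all: by move=> p p' q q' -> ->.
Qed.

Lemma identities_cong V : loop_cong (identities V).
Proof.
split.
- by move=> p q pq X _ v; exact: pq.
- by move=> p q pq X VX v; symmetry; exact: pq.
- by move=> q p r pq qr X VX v; exact: etrans (pq X VX v) (qr X VX v).
- move=> p p' q q' pp' qq' X VX v; exact: (congr2 lmul (pp' X VX v) (qq' X VX v)).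
- move=> p p' q q' pp' qq' X VX v; exact: (congr2 lldiv (pp' X VX v) (qq' X VX v)).
- move=> p p' q q' pp' qq' X VX v; exact: (congr2 lrdiv (pp' X VX v) (qq' X VX v)).
Qed.

Lemma meet_cong E F : loop_cong E -> loop_cong F -> loop_cong (meet_rel E F).
Proof.
move=> cE cF; split.
- by move=> p q pq; split; [apply: cong_id cE _ _ _|apply: cong_id cF _ _ _].
- by move=> p q [? ?]; split; [apply: cong_sym cE _ _ _|apply: cong_sym cF _ _ _].
- move=> q p r [? ?] [? ?]; split.
    by apply: (cong_trans cE (q := q)).
  by apply: (cong_trans cF (q := q)).
- by move=> p p' q q' [? ?] [? ?]; split; [apply: (cong_mul cE)|apply: (cong_mul cF)].
- by move=> p p' q q' [? ?] [? ?]; split; [apply: (cong_ldiv cE)|apply: (cong_ldiv cF)].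
- by move=> p p' q q' [? ?] [? ?]; split; [apply: (cong_rdiv cE)|apply: (cong_rdiv cF)].
Qed.

(* [p (r \ q)] is a Mal'cev term for loops. *)
Lemma comp_relC E F p q :
  loop_cong E -> loop_cong F -> comp_rel E F p q -> comp_rel F E p q.
Proof.
move=> cE cF [r pr rq]; exists (Mul p (LDiv r q)).
  apply: (cong_trans cF (q := Mul p (LDiv r r))).
    apply: (cong_id cF) => X v /=.
    by rewrite -{2}(loop_mul_1r (loop_eval v r)) loop_ldiv_mul loop_mul_1r.
  by apply: (cong_mul cF); [|apply: (cong_ldiv cF)] => //; apply: cong_refl.
apply: (cong_trans cE (q := Mul r (LDiv r q))).
  by apply: (cong_mul cE) => //; apply: cong_refl.
by apply: (cong_id cE) => X v /=; rewrite loop_mul_ldiv.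
Qed.

(** Symmetry and transitivity come from permutability, which lets adjacent factors be exchanged. *)
Lemma comp_cong E F : loop_cong E -> loop_cong F -> loop_cong (comp_rel E F).
Proof.
move=> cE cF; split.
- by move=> p q pq; exists p; [exact: cong_refl|apply: cong_id cF _ _ _].
- move=> p q [r pr rq]; apply: comp_relC => //.
  by exists r; [apply: (cong_sym cF)|apply: (cong_sym cE)].
- move=> q p r [a pa aq] [b qb br].
  have [c ac cb] : comp_rel E F a b by apply: comp_relC => //; exists q.
  by exists c; [apply: (cong_trans cE) ac|apply: (cong_trans cF) br].
- move=> p p' q q' [a pa ap'] [b qb bq']; exists (Mul a b).
    exact: (cong_mul cE).
  exact: (cong_mul cF).
- move=> p p' q q' [a pa ap'] [b qb bq']; exists (LDiv a b).
    exact: (cong_ldiv cE).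
  exact: (cong_ldiv cF).
- move=> p p' q q' [a pa ap'] [b qb bq']; exists (RDiv a b).
    exact: (cong_rdiv cE).
  exact: (cong_rdiv cF).
Qed.

(** A congruence is determined by its class of [One], so inclusions of congruences can be read off
    from kernels. *)
Lemma cong_ldiv1 E p q : loop_cong E -> E p q <-> E (LDiv p q) One.
Proof.
move=> cE; split=> [pq|pq1].
  apply: (cong_trans cE (q := LDiv p p)).
    by apply: (cong_ldiv cE); [exact: cong_refl|exact: (cong_sym cE)].
  apply: (cong_id cE) => X v /=.
  by rewrite -{2}(loop_mul_1r (loop_eval v p)) loop_ldiv_mul.
apply: (cong_trans cE (q := Mul p One)).
  by apply: (cong_id cE) => X v /=; rewrite loop_mul_1r.
apply: (cong_trans cE (q := Mul p (LDiv p q))).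
  by apply: (cong_mul cE); [exact: cong_refl|exact: (cong_sym cE)].
by apply: (cong_id cE) => X v /=; rewrite loop_mul_ldiv.
Qed.

(** * Quotients of the term algebra *)

Section Quotient.
Variables (E : term -> term -> Prop) (cE : loop_cong E).

Definition quot := {A : term -> Prop | exists p, A = E p}.
Definition class p : quot := exist _ (E p) (ex_intro _ p erefl).
Definition repr (A : quot) : term := projT1 (cid (svalP A)).

Lemma classP p q : class p = class q <-> E p q.
Proof.
split=> [/(congr1 sval) /= ->|pq]; first exact: cong_refl.
apply: sval_inj => /=; apply/funext => r; apply/propext; split.
  by apply: (cong_trans cE); exact: (cong_sym cE).
exact: (cong_trans cE).
Qed.

Lemma reprK A : class (repr A) = A.
Proof.
apply: sval_inj => /=.
by rewrite /repr; case: cid => p /= <-.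
Qed.

Lemma repr_class p : E (repr (class p)) p.
Proof. by apply/classP; rewrite reprK. Qed.

Definition quot_loop : loop.
Proof.
apply: (@Loop quot (fun A B => class (Mul (repr A) (repr B)))
  (fun A B => class (LDiv (repr A) (repr B)))
  (fun A B => class (RDiv (repr A) (repr B))) (class One)).
- move=> A B; rewrite -[RHS]reprK; apply/classP.
  apply: (cong_trans cE (q := Mul (repr A) (LDiv (repr A) (repr B)))).
    by apply: (cong_mul cE); [exact: cong_refl|exact: repr_class].
  by apply: (cong_id cE) => X v /=; rewrite loop_mul_ldiv.
- move=> A B; rewrite -[RHS]reprK; apply/classP.
  apply: (cong_trans cE (q := LDiv (repr A) (Mul (repr A) (repr B)))).
    by apply: (cong_ldiv cE); [exact: cong_refl|exact: repr_class].
  by apply: (cong_id cE) => X v /=; rewrite loop_ldiv_mul.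
- move=> A B; rewrite -[RHS]reprK; apply/classP.
  apply: (cong_trans cE (q := Mul (RDiv (repr A) (repr B)) (repr B))).
    by apply: (cong_mul cE); [exact: repr_class|exact: cong_refl].
  by apply: (cong_id cE) => X v /=; rewrite loop_rdiv_mul.
- move=> A B; rewrite -[RHS]reprK; apply/classP.
  apply: (cong_trans cE (q := RDiv (Mul (repr A) (repr B)) (repr B))).
    by apply: (cong_rdiv cE); [exact: repr_class|exact: cong_refl].
  by apply: (cong_id cE) => X v /=; rewrite loop_mul_rdiv.
- move=> A; rewrite -[RHS]reprK; apply/classP.
  apply: (cong_trans cE (q := Mul One (repr A))).
    by apply: (cong_mul cE); [exact: repr_class|exact: cong_refl].
  by apply: (cong_id cE) => X v /=; rewrite loop_mul_1l.
- move=> A; rewrite -[RHS]reprK; apply/classP.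
  apply: (cong_trans cE (q := Mul (repr A) One)).
    by apply: (cong_mul cE); [exact: cong_refl|exact: repr_class].
  by apply: (cong_id cE) => X v /=; rewrite loop_mul_1r.
Defined.

Lemma eval_quot (J : Type) (s : J -> term) (t : loop_term J) :
  loop_eval (fun j => class (s j) : quot_loop) t = class (subst s t).
Proof.
elim: t => //= t1 -> t2 ->; apply/classP.
- by apply: (cong_mul cE); exact: repr_class.
- by apply: (cong_ldiv cE); exact: repr_class.
- by apply: (cong_rdiv cE); exact: repr_class.
Qed.

Lemma subst_Var p : subst (@Var I) p = p.
Proof. by elim: p => //= p -> q ->. Qed.

Lemma eval_quot_Var p q :
  loop_eval (fun i => class (Var i) : quot_loop) p =
    loop_eval (fun i => class (Var i) : quot_loop) q <-> E p q.
Proof. by rewrite !eval_quot !subst_Var; exact: classP. Qed.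

(** Lifting an assignment to representatives turns an axiom of [V] into a substitution instance,
    which is an identity of [V] and hence lies in [E]. *)
Lemma quot_variety (V : loop -> Prop) : is_variety V ->
  (forall p q, identities V p q -> E p q) -> V quot_loop.
Proof.
move=> [Eq VE] VleE; apply/VE => -[l r] lr v.
have -> : v = fun j => class (repr (v j)) by apply/funext => j; rewrite reprK.
rewrite /holds_at !eval_quot /=; apply/classP/VleE => Z VZ u.
by rewrite /holds_at /= !eval_subst; exact: ((VE Z).1 VZ _ lr).
Qed.

End Quotient.

(** * Evaluations with simple image *)

(** The full relation qualifies, just as the trivial loop satisfies [is_simple]. *)
Definition maximal_cong E := forall F, loop_cong F ->
  (forall p q, E p q -> F p q) ->
  (forall p q, F p q -> E p q) \/ (forall p q, F p q).

Section SimpleImage.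
Variables (X : loop) (v : I -> X) (S : set X) (HS : is_subloop S).
Hypothesis evS : S = range (loop_eval v).

Let lift p : loop_of_subloop HS.
Proof. by exists (loop_eval v p); rewrite evS; exists p. Defined.

Let lift_surj (y : loop_of_subloop HS) : exists p, lift p = y.
Proof.
case: y => y Sy; have := Sy; rewrite {1}evS => -[p _ py].
by exists p; apply: sval_inj.
Qed.

Let liftP p q : lift p = lift q <-> eval_rel v p q.
Proof. by split=> [/(congr1 sval)|pq] //; apply: sval_inj. Qed.

(** A congruence [F] above the kernel of evaluation induces a homomorphism from the image to the
    quotient by [F]. Its kernel is the image of the class of [One], so simplicity leaves only the
    two extreme cases. *)
Lemma simple_image_maximal :
  is_simple (loop_of_subloop HS) -> maximal_cong (eval_rel v).
Proof.
move=> simpleS F cF vF.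
pose f (y : loop_of_subloop HS) : quot_loop cF :=
  class F (projT1 (cid (lift_surj y))).
have fE p : f (lift p) = class F p.
  rewrite /f; case: cid => q /= /liftP qp.
  by apply/(classP cF)/vF.
have f_hom : is_hom f.
  split.
  - move=> y z; have [[p <-] [q <-]] := (lift_surj y, lift_surj z).
    have -> : lmul (lift p) (lift q) = lift (Mul p q) by apply: sval_inj.
    rewrite !fE /=; apply/(classP cF)/(cong_mul cF); apply: (cong_sym cF);
      exact: repr_class.
  - move=> y z; have [[p <-] [q <-]] := (lift_surj y, lift_surj z).
    have -> : lldiv (lift p) (lift q) = lift (LDiv p q) by apply: sval_inj.
    rewrite !fE /=; apply/(classP cF)/(cong_ldiv cF); apply: (cong_sym cF);
      exact: repr_class.
  - move=> y z; have [[p <-] [q <-]] := (lift_surj y, lift_surj z).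
    have -> : lrdiv (lift p) (lift q) = lift (RDiv p q) by apply: sval_inj.
    rewrite !fE /=; apply/(classP cF)/(cong_rdiv cF); apply: (cong_sym cF);
      exact: repr_class.
  - have -> : @lone (loop_of_subloop HS) = lift One by apply: sval_inj.
    exact: fE.
have kerf p : (f @^-1` [set lone]) (lift p) <-> F p One.
  by rewrite /= fE; exact: (classP cF).
have : is_normal_subloop (f @^-1` [set lone]) by exists (quot_loop cF), f.
case/simpleS => kerE; [left|right] => p q.
  move=> /(cong_ldiv1 _ _ cF) /kerf; rewrite kerE => /= pq1.
  apply/(cong_ldiv1 _ _ (eval_cong v))/liftP; rewrite pq1.
  exact: sval_inj.
by apply/(cong_ldiv1 _ _ cF)/kerf; rewrite kerE.
Qed.

Lemma image_abelian :
  (forall p q r, eval_rel v (Mul p (Mul q r)) (Mul (Mul p q) r)) ->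
  (forall p q, eval_rel v (Mul p q) (Mul q p)) ->
  is_abelian (loop_of_subloop HS).
Proof.
move=> vA vC; exists (fun y => lrdiv lone y); split.
- move=> x y z.
  have [[p <-] [q <-] ] := (lift_surj x, lift_surj y).
  by have [r <-] := lift_surj z; apply: sval_inj; exact: vA.
- move=> x y; have [[p <-] [q <-]] := (lift_surj x, lift_surj y).
  by apply: sval_inj; exact: vC.
- by move=> x; exact: loop_mul_1l.
- by move=> x; exact: loop_rdiv_mul.
Qed.

(* Replacing [p] and [q] by terms [a] and [b] with the same values and with
   [E a 1], [F b 1], the two sides of each law at [a, b] are congruent modulo [E]
   (put [a = 1]) and modulo [F] (put [b = 1]). *)
Lemma meet_le_image_abelian E F : loop_cong E -> loop_cong F ->
  (forall p q, comp_rel E (eval_rel v) p q) ->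
  (forall p q, comp_rel F (eval_rel v) p q) ->
  (forall p q, meet_rel E F p q -> eval_rel v p q) ->
  is_abelian (loop_of_subloop HS).
Proof.
move=> cE cF Efull Ffull EFv.
have ker G p : loop_cong G -> (forall p q, comp_rel G (eval_rel v) p q) ->
    exists2 a, G a One & loop_eval v a = loop_eval v p.
  move=> cG /(_ One p)[a aG ap]; exists a => //; exact: cong_sym cG _ _ aG.
have laws p q a b : E a One -> F b One ->
    (forall (Z : loop) (u : I -> Z),
      loop_eval u a = lone \/ loop_eval u b = lone ->
      loop_eval u p = loop_eval u q) -> eval_rel v p q.
  move=> /(eval_quot_Var cE) /= a1 /(eval_quot_Var cF) /= b1 pq; apply: EFv.
  by split; [apply/(eval_quot_Var cE)|apply/(eval_quot_Var cF)];
    apply: pq; [left|right].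
apply: image_abelian => p q.
  move=> r; have [a a1 ap] := ker _ p cE Efull.
  have [b b1 bq] := ker _ q cF Ffull.
  have := laws (Mul a (Mul b r)) (Mul (Mul a b) r) _ _ a1 b1.
  rewrite /eval_rel /= ap bq; apply=> Z u [] ->.
    by rewrite !loop_mul_1l.
  by rewrite loop_mul_1l loop_mul_1r.
have [a a1 ap] := ker _ p cE Efull; have [b b1 bq] := ker _ q cF Ffull.
have := laws (Mul a b) (Mul b a) _ _ a1 b1.
by rewrite /eval_rel /= ap bq; apply=> Z u [] ->;
  rewrite loop_mul_1l loop_mul_1r.
Qed.

End SimpleImage.

(** * Composition with maximal congruences *)

Lemma maximal_comp E H : loop_cong E -> loop_cong H -> maximal_cong H ->
  (forall p q, E p q -> H p q) \/ (forall p q, comp_rel E H p q).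
Proof.
move=> cE cH /(_ _ (comp_cong cE cH))[p q pq|EH|]; last by right.
  by exists p; first exact: cong_refl.
by left=> p q pq; apply: EH; exists q; last exact: cong_refl.
Qed.

(** The negated inclusion is supplied by a nonabelian image, and the conditional [H p q] by
    propagation in [X]. *)
Lemma comp_meet_maximal E F H p q :
  loop_cong E -> loop_cong F -> loop_cong H -> maximal_cong H ->
  ((forall p q, comp_rel E H p q) -> (forall p q, comp_rel F H p q) ->
   ~ (forall p q, meet_rel E F p q -> H p q)) ->
  ((forall p q, E p q -> H p q) -> H p q) ->
  comp_rel E F p q -> comp_rel E (meet_rel F H) p q.
Proof.
move=> cE cF cH maxH nonab Hpq [m pm mq].
have [EH|EHfull] := maximal_comp cE cH maxH.
  (* Both [m] and [q] are [H]-related to [p], so the old middle term still works. *)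
  exists m => //; split => //; apply: (cong_trans cH (q := p)); last exact: Hpq.
  by apply: (cong_sym cH); exact: EH.
have [FH|FHfull] := maximal_comp cF cH maxH.
  by exists m => //; split=> //; exact: FH.
(* Once [nonab] excludes the inclusion, [m] can be moved to some [h] that is [H]-related to [q],
   without leaving its classes modulo [E] and [F]. *)
have [|/(_ m q)[h [mhE mhF] hq]] := maximal_comp (meet_cong cE cF) cH maxH.
  by move/(nonab EHfull FHfull).
exists h; first exact: (cong_trans cE) pm mhE.
by split=> //; apply: (cong_trans cF) mq; exact: (cong_sym cF).
Qed.

End Congruences.

(** * Enumeration of tuples and the final induction *)

Lemma finite_tuples (n : nat) (X : Type) : finite_set [set: X] ->
  exists (J : finType) (e : J -> 'I_n -> X), forall a, exists j, e j = a.
Proof.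
move=> /(@finite_seqP {classic X})[s sX].
exists {ffun 'I_n -> seq_sub s}, 
  (fun (j : {ffun 'I_n -> seq_sub s}) i => ssval (j i)) => a.
have as_ i : (a i : {classic X}) \in s.
  by have : [set: {classic X}] (a i) by []; rewrite sX.
exists [ffun i => SeqSub (as_ i)].
by apply/funext => i; rewrite ffunE.
Qed.

Theorem theorem5p6 (V : loop -> Prop) (hV : is_variety V)
    (X : loop) (finX : finite_set [set: X])
    (hX : forall (S : set X) (HS : is_subloop S),
        V (loop_of_subloop HS) \/
        (~ is_abelian (loop_of_subloop HS) /\ is_simple (loop_of_subloop HS)))
    (n : nat) (eps : loop_equation 'I_n)
    (epsX : propagates eps X) (epsV : propagates_in eps V) :
  propagates_in eps (variety_join (HSP X) V).
Proof.
move=> Y YW x epsx y; rewrite generated_range_eval => yx.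
have /choice[s sy] i : exists p, loop_eval x p = y i.
  by have [p _ <-] := yx i; exists p.
have -> : y = fun i => loop_eval x (s i) by apply/funext => i.
rewrite /holds_at -!eval_subst.
(* The pair ([p], [q]) is the consequence [w] of [eps]; the goal is [K p q]. *)
set p := subst s eps.1; set q := subst s eps.2.
pose K := eval_rel x; have cK : loop_cong K by exact: eval_cong.
pose G := @identities 'I_n V; have cG : loop_cong G by exact: identities_cong.
pose H (a : 'I_n -> X) := eval_rel a.
have cH a : loop_cong (H a) by exact: eval_cong.
(* An identity of [V] that holds at every tuple of [X] holds in [HSP X], hence in the join, and so
   at [x] in [Y]. *)
have meetK p' q' : G p' q' -> (forall a, H a p' q') -> K p' q'.
  move=> Gpq Hpq; apply: (satisfies_generated_variety _ YW) => Z [|VZ].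
    by apply: satisfies_generated_variety => _ -> a; exact: Hpq.
  exact: Gpq.
have Hpq a : (forall p q, K p q -> H a p q) -> H a p q.
  by move=> KH; apply: (propagates_subst s epsX); exact: KH.
have [J [e e_surj]] := finite_tuples n finX.
(* [F] is the meet built so far. Once every tuple is treated, [meetK] gives [F <= K], and [K o F]
   collapses to [K]. *)
suff [F [_ FG FH [r pr rq]]] : exists F : loop_term 'I_n -> _ -> Prop,
    [/\ loop_cong F, forall p q, F p q -> G p q,
     forall j, j \in enum J -> forall p q, F p q -> H (e j) p q &
     comp_rel K F p q].
  apply: (cong_trans cK) pr _; apply: meetK => [|a]; first exact: FG.
  by have [j <-] := e_surj a; apply: FH rq; rewrite mem_enum.
elim: (enum J) => [|j js [F [cF FG FH KF]]].
  exists G; split=> //.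
  (* The quotient by [K o G] lies in [V] and satisfies [eps] at the classes of the variables, so
     propagation in [V] applies there. *)
  have cKG := comp_cong cK cG; apply/(eval_quot_Var cKG).
  apply: (@propagates_subst _ eps (quot_loop cKG)).
    apply/epsV/(quot_variety cKG hV) => p' q' Gpq.
    by exists p' => //; exact: cong_refl.
  apply/(eval_quot_Var cKG); exists eps.2 => //; exact: cong_refl.
have HS := range_eval_subloop (e j).
have [VS|[nonab simple]] := hX _ HS.
  (* The tuple [e j] lifts to a tuple [u] of its image, a member of [V], so [F <= G <= H (e j)] and
     [F] is kept. *)
  exists F; split=> // i; rewrite inE => /orP[/eqP -> p' q' /FG Gpq|/FH //].
  pose u i : loop_of_subloop HS :=
    exist _ (e j i) (ex_intro2 _ _ (Var i) I erefl).
  have := congr1 sval (Gpq _ VS u).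
  by rewrite !(hom_eval _ _ (sval_hom HS)).
exists (meet_rel F (H (e j))); split; first exact: meet_cong.
- by move=> p' q' [/FG].
- by move=> i; rewrite inE => /orP[/eqP -> p' q' []|/FH FHi p' q' [/FHi]].
- apply: comp_meet_maximal => //; first exact: simple_image_maximal simple.
    move=> Kfull Ffull KFH; apply: nonab.
    exact: (meet_le_image_abelian HS erefl cK cF Kfull Ffull KFH).
  exact: Hpq.
Qed.
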